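(* Let $(\mathfrak g,[\cdot,\cdot],\alpha)$ be a multiplicative Hom-Lie superalgebra over $\mathbb K$ and let $n\ge 2$. Then $\mathfrak g_n=(\mathfrak g,[\cdot,\dots,\cdot]_n,\alpha^{n-1})$ is a multiplicative $n$-ary Hom-Nambu superalgebra, where $[x_1,x_2]_2=[x_1,x_2]$ and, for $m\ge 3$, $[x_1,\dots,x_m]_m=\big[[x_1,\dots,x_{m-1}]_{m-1},\alpha^{m-2}(x_m)\big]$.
   Context: $\mathbb K$ is an algebraically closed field of characteristic zero. For a $\mathbb Z_2$-graded linear space, $|v|\in\mathbb Z_2$ denotes the degree of a homogeneous element $v$; a map is even if it preserves total degree. $\alpha^k$ is the $k$-fold composition of $\alpha$. A Hom-Lie superalgebra $(\mathfrak g,[\cdot,\cdot],\alpha)$ is a $\mathbb Z_2$-graded linear space with an even bilinear map $[\cdot,\cdot]$ and an even linear map $\alpha:\mathfrak g\to\mathfrak g$ such that for homogeneous $x,y,z$: $[x,y]=-(-1)^{|x||y|}[y,x]$ and $(-1)^{|x||z|}[\alpha(x),[y,z]]+(-1)^{|y||x|}[\alpha(y),[z,x]]+(-1)^{|z||y|}[\alpha(z),[x,y]]=0$. It is multiplicative if $\alpha([x,y])=[\alpha(x),\alpha(y)]$. A multiplicative $n$-ary Hom-Nambu superalgebra $(\mathcal N,[\cdot,\dots,\cdot],\beta)$ is a $\mathbb Z_2$-graded linear space with an even $n$-linear bracket and an even linear map $\beta$ such that $\beta([x_1,\dots,x_n])=[\beta(x_1),\dots,\beta(x_n)]$ and, for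 all homogeneous $x_1,\dots,x_{n-1},y_1,\dots,y_n$, $$[\beta(x_1),\dots,\beta(x_{n-1}),[y_1,\dots,y_n]]=\sum_{i=1}^n(-1)^{|X||Y|^{i-1}}[\beta(y_1),\dots,\beta(y_{i-1}),[x_1,\dots,x_{n-1},y_i],\beta(y_{i+1}),\dots,\beta(y_n)],$$ where $|X|=\sum_{k=1}^{n-1}|x_k|$ and $|Y|^{i-1}=\sum_{k=1}^{i-1}|y_k|$ (no skew-symmetry of the bracket is required). *)

(* Defs.v *)
From mathcomp Require Import all_boot all_order all_algebra.

Set Implicit Arguments.
Unset Strict Implicit.
Unset Printing Implicit Defensive.

Import GRing.Theory.
Local Open Scope ring_scope.

(* A Z_2-grading V = V_0 (+) V_1.  "x is homogeneous of degree d" is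
   [homog G d x]; as usual 0 is homogeneous of both degrees, so statements about
   homogeneous elements quantify over a degree together with an element of the
   corresponding component. *)
Record Z2_grading (K : fieldType) (V : lmodType K) := Z2Grading {
  homog : 'Z_2 -> V -> Prop;
  homog0 : forall d, homog d 0;
  homogD : forall d (a : K) u v,
    homog d u -> homog d v -> homog d (a *: u + v);
  homog_span : forall v, exists f : 'Z_2 -> V,
    (forall d, homog d (f d)) /\ v = \sum_(d : 'Z_2) f d;
  homog_direct : forall v, homog 0 v -> homog 1 v -> v = 0
}.

(* (-1)^d; the exponent is read off the representative 0 or 1 of d. *)
Definition Z2sign (K : fieldType) (d : 'Z_2) : K := (-1) ^+ (d : nat).

Section SuperAlgebras.
Variables (K : fieldType) (V : lmodType K) (G : Z2_grading V).

Definition even_map (f : V -> V) : Prop :=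
  forall d x, homog G d x -> homog G d (f x).

Record hom_lie_superalgebra (br : V -> V -> V) (alpha : V -> V) : Prop := {
  hls_linearl : forall y, linear (fun x => br x y);
  hls_linearr : forall x, linear (br x);
  hls_even : forall a b x y,
    homog G a x -> homog G b y -> homog G (a + b) (br x y);
  hls_alpha_linear : linear alpha;
  hls_alpha_even : even_map alpha;
  hls_skew : forall a b x y, homog G a x -> homog G b y ->
    br x y = - (Z2sign K (a * b) *: br y x);
  hls_jacobi : forall a b c x y z,
    homog G a x -> homog G b y -> homog G c z ->
    Z2sign K (a * c) *: br (alpha x) (br y z)
    + Z2sign K (b * a) *: br (alpha y) (br z x)
    + Z2sign K (c * b) *: br (alpha z) (br x y) = 0
}.

Record multiplicative_hom_lie_superalgebra
    (br : V -> V -> V) (alpha : V -> V) : Prop := {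
  mhls_hls : hom_lie_superalgebra br alpha;
  mhls_mult : forall x y, alpha (br x y) = br (alpha x) (alpha y)
}.

(* The n-tuple y with its i-th entry replaced by v. *)
Definition subst_at n (y : {ffun 'I_n -> V}) (i : 'I_n) (v : V) :
    {ffun 'I_n -> V} :=
  [ffun j => if j == i then v else y j].

(* The n-tuple (x_1, ..., x_(n-1), v), for n >= 1. *)
Definition append_last n (x : {ffun 'I_n.-1 -> V}) (v : V) :
    {ffun 'I_n -> V} :=
  [ffun j : 'I_n => if insub (j : nat) is Some k then x k else v].

Definition map_tuple n (f : V -> V) (x : {ffun 'I_n -> V}) :
    {ffun 'I_n -> V} :=
  [ffun j => f (x j)].

Definition n_linear n (br : {ffun 'I_n -> V} -> V) : Prop :=
  forall (x : {ffun 'I_n -> V}) (i : 'I_n),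
    linear (fun v => br (subst_at x i v)).

Definition n_even n (br : {ffun 'I_n -> V} -> V) : Prop :=
  forall (d : 'I_n -> 'Z_2) (x : {ffun 'I_n -> V}),
    (forall i, homog G (d i) (x i)) -> homog G (\sum_(i < n) d i) (br x).

(* Indices are 0-based: |Y|^(i-1) is the sum of the degrees of the entries
   strictly before the i-th one. *)
Definition super_hom_nambu_identity n
    (br : {ffun 'I_n -> V} -> V) (beta : V -> V) : Prop :=
  forall (d : 'I_n.-1 -> 'Z_2) (e : 'I_n -> 'Z_2)
         (x : {ffun 'I_n.-1 -> V}) (y : {ffun 'I_n -> V}),
    (forall k, homog G (d k) (x k)) -> (forall k, homog G (e k) (y k)) ->
    br (append_last (map_tuple beta x) (br y)) =
    \sum_(i < n)
      Z2sign K ((\sum_(k < n.-1) d k) * (\sum_(k < n | (k < i)%N) e k))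
      *: br (subst_at (map_tuple beta y) i (br (append_last x (y i)))).

Record multiplicative_hom_nambu_superalgebra n
    (br : {ffun 'I_n -> V} -> V) (beta : V -> V) : Prop := {
  mhns_linear : n_linear br;
  mhns_even : n_even br;
  mhns_beta_linear : linear beta;
  mhns_beta_even : even_map beta;
  mhns_mult : forall x, beta (br x) = br (map_tuple beta x);
  mhns_nambu : super_hom_nambu_identity br beta
}.

(* [x_1, ..., x_n]_n.  Only the arities n >= 2 are meaningful; the values at
   n = 0 and n = 1 are placeholders, and are not used by the recursion. *)
Fixpoint iterated_bracket (br : V -> V -> V) (alpha : V -> V) (n : nat) :
    {ffun 'I_n -> V} -> V :=
  match n return {ffun 'I_n -> V} -> V with
  | 0 => fun _ => 0
  | m.+1 =>
    match m return ({ffun 'I_m -> V} -> V) -> {ffun 'I_m.+1 -> V} -> V with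
    | 0 => fun _ _ => 0
    | 1 => fun _ x => br (x ord0) (x ord_max)
    | k.+2 => fun br_m x =>
        br (br_m [ffun i => x (widen_ord (leqnSn k.+2) i)])
           (iter k.+1 alpha (x ord_max))
    end (iterated_bracket br alpha (n := m))
  end.

End SuperAlgebras.

(* Main.v *)
Require Import Defs.
From mathcomp Require Import all_boot all_order all_algebra.

Set Implicit Arguments.
Unset Strict Implicit.
Unset Printing Implicit Defensive.

Import GRing.Theory.
Local Open Scope ring_scope.

(** Up to skew-symmetry, the super Hom-Jacobi identity says that bracketing on
    the left is a twisted superderivation of the binary bracket:
      [alpha x, [y, z]] = [[x, y], alpha z] + (-1)^(|x||y|) [alpha y, [x, z]]
    ([hom_leibniz]).  Applying this once for each of the nested brackets in
    Y = [y_0, ..., y_m] turns it into a derivation rule for the iterated bracket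
    ([left_bracket_derivation]):
      [alpha^m X, Y]
        = sum_i (-1)^(|X| (|y_0| + ... + |y_(i-1)|))
            [alpha y_0, ..., [X, y_i], ..., alpha y_m].
    In the induction on m the outermost bracket of Y is
    [[y_0, ..., y_(m-1)], alpha^(m-1) y_m]; the Leibniz rule gives one term to
    which the induction hypothesis applies, and one term which is the summand of
    index m once multiplicativity has moved the powers of alpha inside.

    The n-ary identity is an instance of this rule.  With m = n - 1 and
    X = [x_1, ..., x_(n-1)], the definition of the n-ary bracket gives
    [x_1, ..., x_(n-1), v] = [X, alpha^(n-2) v], so by multiplicativity the left
    side of the identity is [alpha^(n-1) X, [z_1, ..., z_n]] with
    z_i = alpha^(n-2) y_i, and the i-th summand on the right contains
    [X, z_i] in a bracket of the elements alpha z_j. *)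

Section Z2Sign.
Variable K : fieldType.

Lemma Z2signD (a b : 'Z_2) : Z2sign K (a + b) = Z2sign K a * Z2sign K b.
Proof.
by rewrite /Z2sign -exprD -[LHS]signr_odd -[RHS]signr_odd /= modn2 oddb.
Qed.

Lemma Z2sign_sqr (a : 'Z_2) : Z2sign K a * Z2sign K a = 1.
Proof. by rewrite -expr2 sqrr_sign. Qed.

End Z2Sign.

Section LeftBracket.
Variables (K : fieldType) (V : lmodType K).
Variables (br : V -> V -> V) (alpha : V -> V).

(** The bracket of y 0, ..., y m, of arity m + 1.  Starting at arity one, where
    the bracket is y 0, makes the recursion uniform and gives inductions a
    trivial base case; indexing by nat avoids casts between ordinal types. *)
Fixpoint left_bracket (m : nat) (y : nat -> V) : V :=
  if m is k.+1 then br (left_bracket k y) (iter k alpha (y m)) else y 0.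

Lemma eq_left_bracket m (y z : nat -> V) :
  (forall j, (j <= m)%N -> y j = z j) -> left_bracket m y = left_bracket m z.
Proof.
elim: m => [|m IHm] yz /=; first exact: yz.
by rewrite yz // IHm // => j le_jm; apply: yz; apply: leqW.
Qed.

(** Stated for every family y extending the tuple x, so that each use can pick
    a convenient extension: an update of y at one index stands for
    [subst_at], and an update at index n - 1 for [append_last]. *)
Lemma iterated_bracketE m (x : {ffun 'I_m.+2 -> V}) (y : nat -> V) :
  (forall j : 'I_m.+2, y j = x j) ->
  iterated_bracket br alpha x = left_bracket m.+1 y.
Proof.
elim: m x => [|m IHm] x yx /=; first by rewrite -!yx.
congr br; last by rewrite -yx.
by rewrite -[RHS]/(left_bracket m.+1 y); apply: IHm => j; rewrite ffunE -yx.
Qed.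

End LeftBracket.

Section HomLieSuperalgebra.
Variables (K : fieldType) (V : lmodType K) (G : Z2_grading V).
Variables (br : V -> V -> V) (alpha : V -> V).
Hypothesis g_mhls : multiplicative_hom_lie_superalgebra G br alpha.

Let g_hls := mhls_hls g_mhls.
Let lb := left_bracket br alpha.

Lemma brPl a u v z : br (a *: u + v) z = a *: br u z + br v z.
Proof. exact: (hls_linearl g_hls z). Qed.

Lemma brPr a u v z : br z (a *: u + v) = a *: br z u + br z v.
Proof. exact: (hls_linearr g_hls z). Qed.

Lemma br0l z : br 0 z = 0.
Proof. by have := brPl (-1) 0 0 z; rewrite scaler0 addr0 scaleN1r addNr. Qed.

Lemma br0r z : br z 0 = 0.
Proof. by have := brPr (-1) 0 0 z; rewrite scaler0 addr0 scaleN1r addNr. Qed.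

Lemma brZr a u z : br z (a *: u) = a *: br z u.
Proof. by rewrite -[a *: u]addr0 brPr br0r addr0. Qed.

Lemma br_suml (I : finType) (c : I -> K) (F : I -> V) z :
  br (\sum_i c i *: F i) z = \sum_i c i *: br (F i) z.
Proof.
elim/big_rec2: _ => [|i w u _ <-]; first exact: br0l.
exact: brPl.
Qed.

Lemma iter_alpha_linear k : linear (iter k alpha).
Proof.
by elim: k => // k IHk a u v; rewrite !iterS IHk (hls_alpha_linear g_hls).
Qed.

Lemma iter_alpha_even k : even_map G (iter k alpha).
Proof.
by elim: k => // k IHk d x /IHk; rewrite iterS; apply: (hls_alpha_even g_hls).
Qed.

Lemma iter_alpha_br k x y :
  iter k alpha (br x y) = br (iter k alpha x) (iter k alpha y).
Proof. by elim: k => //= k ->; rewrite (mhls_mult g_mhls). Qed.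

(** The super Hom-Jacobi identity, after the two outer brackets are put in the
    order x, y, z by skew-symmetry and the common sign is divided out. *)
Lemma hom_leibniz a b c x y z :
    homog G a x -> homog G b y -> homog G c z ->
  br (alpha x) (br y z) =
  br (br x y) (alpha z) + Z2sign K (a * b) *: br (alpha y) (br x z).
Proof.
move=> hx hy hz; have := hls_jacobi g_hls hx hy hz.
have haz := hls_alpha_even g_hls hz.
rewrite (hls_skew g_hls hz hx) (hls_skew g_hls haz (hls_even g_hls hx hy)).
(* The signs of the three terms become s(ac), - s(ac) s(ab) and
   - s(cb) s(ca) s(cb) = - s(ac), where s(d) = (-1)^d; s(ac) is its own
   inverse. *)
rewrite -scaleNr brZr scalerN !scalerA mulrN (mulrC b a) (mulrC c a).
rewrite mulrDr Z2signD (mulrC c a) (mulrC (Z2sign K (a * c)) (Z2sign K (c * b))).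
rewrite mulrA Z2sign_sqr mul1r (mulrC (Z2sign K (a * b))) scaleNr.
rewrite -scalerA -!scalerBr.
move/(congr1 ( *:%R (Z2sign K (a * c)))).
rewrite scalerA Z2sign_sqr scale1r scaler0 => /eqP.
by rewrite addrAC !subr_eq add0r addrC => /eqP.
Qed.

Lemma iter_alpha_left_bracket k m y :
  iter k alpha (lb m y) = lb m (iter k alpha \o y).
Proof.
by elim: m => //= m IHm; rewrite iter_alpha_br IHm -!iterD addnC.
Qed.

Lemma left_bracket_even m (e : nat -> 'Z_2) y :
  (forall j, (j <= m)%N -> homog G (e j) (y j)) ->
  homog G (\sum_(k < m.+1) e k) (lb m y).
Proof.
elim: m => [|m IHm] hy; first by rewrite big_ord1; apply: hy.
rewrite big_ord_recr /=; apply: (hls_even g_hls).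
  by apply: IHm => j le_jm; apply: hy; apply: leqW.
by apply: iter_alpha_even; apply: hy.
Qed.

Lemma left_bracket_linear m i y :
  (i <= m)%N -> linear (fun v => lb m [eta y with i |-> v]).
Proof.
elim: m => [|m IHm] le_im a u v; first by case: i le_im.
rewrite /lb /= -/lb; move: le_im; rewrite leq_eqVlt ltnS => /orP[/eqP->|le_im].
  have below w : lb m [eta y with m.+1 |-> w] = lb m y.
    by apply: eq_left_bracket => j le_jm /=; rewrite ltn_eqF.
  by rewrite eqxx !below iter_alpha_linear brPr.
by rewrite IHm // (gtn_eqF (_ : i < m.+1)%N) // brPl.
Qed.

(** Left multiplication by X, twisted by the power of alpha that counts the
    nested brackets, is a superderivation of the iterated bracket. *)
Lemma left_bracket_derivation m p X (e : nat -> 'Z_2) y :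
    homog G p X -> (forall j, (j <= m)%N -> homog G (e j) (y j)) ->
  br (iter m alpha X) (lb m y) =
  \sum_(i < m.+1) Z2sign K (p * \sum_(k < i) e k)
    *: lb m [eta alpha \o y with val i |-> br X (y i)].
Proof.
move=> hX; elim: m => [|m IHm] hy.
  by rewrite big_ord1 big_ord0 mulr0 /Z2sign expr0 scale1r.
have hy' j : (j <= m)%N -> homog G (e j) (y j).
  by move=> le_jm; apply: hy; apply: leqW.
rewrite /lb /= -/lb (hom_leibniz (iter_alpha_even m hX)
  (left_bracket_even hy') (iter_alpha_even m (hy m.+1 (leqnn _)))).
rewrite IHm // br_suml [RHS]big_ord_recr /=; congr (_ + _).
  apply: eq_bigr => i _; congr (_ *: _).
  by rewrite (gtn_eqF (ltn_ord i)) -iterS iterSr.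
(* The sign of the last summand is already that of the Leibniz rule, because
   the iterated bracket of y 0, ..., y m has the sum of their degrees. *)
rewrite eqxx -iter_alpha_br; congr (_ *: br _ _).
rewrite -[alpha _]/(iter 1 alpha _) iter_alpha_left_bracket.
by apply: eq_left_bracket => j le_jm /=; rewrite ltn_eqF.
Qed.

(** The derivation rule for X = [x_1, ..., x_(n-1)] and the entries
    alpha^(n-2) y_i, where n = m + 2. *)
Lemma left_bracket_nambu m : super_hom_nambu_identity G
  (@iterated_bracket K V br alpha m.+2) (iter m.+1 alpha).
Proof.
move=> d e x y hx hy.
pose x' j := x (inord j); pose y' j := y (inord j); pose e' j := e (inord j).
(* The outermost bracket is the only one that involves the last entry. *)
have appendE (z : {ffun 'I_m.+1 -> V}) v :
    iterated_bracket br alpha (append_last (n := m.+2) z v) =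
    br (lb m (fun j => z (inord j))) (iter m alpha v).
  rewrite (@iterated_bracketE _ _ _ _ _ _
    [eta (fun j => z (inord j)) with m.+1 |-> v]) /= ?eqxx => [|j].
    by congr br; apply: eq_left_bracket => j le_jm /=; rewrite ltn_eqF.
  rewrite ffunE; case: insubP => [k _ <-|] /=.
    by rewrite (ltn_eqF (ltn_ord k)) inord_val.
  by rewrite -leqNgt => le_mj; rewrite eqn_leq le_mj -ltnS ltn_ord.
rewrite appendE (@iterated_bracketE _ _ _ _ _ y y') => [|j]; last first.
  by rewrite /y' inord_val.
rewrite (_ : lb m _ = iter m.+1 alpha (lb m x')); last first.
  rewrite iter_alpha_left_bracket; apply: eq_left_bracket => j _.
  by rewrite ffunE.
rewrite -/lb (iter_alpha_left_bracket m).
have hX : homog G (\sum_(k < m.+1) d k) (lb m x').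
  rewrite (eq_bigr (fun k : 'I_m.+1 => d (inord k))) => [|k _].
    by apply: (@left_bracket_even m (fun j => d (inord j))) => j _; apply: hx.
  by rewrite inord_val.
rewrite (@left_bracket_derivation m.+1 _ _ e' _ hX) => [|j _]; last first.
  exact: (iter_alpha_even m (hy _)).
apply: eq_bigr => i _; congr (_ *: _).
  congr (Z2sign K (_ * _)); rewrite (big_ord_widen m.+2 e' (ltnW (ltn_ord i))).
  by apply: eq_bigr => k _; rewrite /e' inord_val.
symmetry; apply: iterated_bracketE => j.
by rewrite !ffunE appendE /= /y' !inord_val (inj_eq val_inj).
Qed.

End HomLieSuperalgebra.

Theorem theorem3p1 (K : closedFieldType) (charK0 : [pchar K] =i pred0)
    (V : lmodType K) (G : Z2_grading V)
    (br : V -> V -> V) (alpha : V -> V) (n : nat) (n_ge2 : (2 <= n)%N)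
    (g_hls : multiplicative_hom_lie_superalgebra G br alpha) :
  multiplicative_hom_nambu_superalgebra G
    (@iterated_bracket K V br alpha n) (iter n.-1 alpha).
Proof.
case: n n_ge2 => [|[|m]] // _.
pose ext (x : {ffun 'I_m.+2 -> V}) j := x (inord j).
have extE x : iterated_bracket br alpha x = left_bracket br alpha m.+1 (ext x).
  by apply: iterated_bracketE => j; rewrite /ext inord_val.
split.
- move=> x i a u v.
  have substE w : iterated_bracket br alpha (subst_at x i w) =
      left_bracket br alpha m.+1 [eta ext x with val i |-> w].
    apply: iterated_bracketE => j.
    by rewrite ffunE /= /ext inord_val (inj_eq val_inj).
  by rewrite !substE (left_bracket_linear g_hls _ (leq_ord i)).
- move=> d x hx; rewrite extE (eq_bigr (fun k : 'I_m.+2 => d (inord k))).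
    apply: (left_bracket_even g_hls (e := fun j => d (inord j))) => j _.
    exact: hx.
  by move=> k _; rewrite inord_val.
- exact: (iter_alpha_linear g_hls).
- exact: (iter_alpha_even g_hls).
- move=> x; rewrite !extE (iter_alpha_left_bracket g_hls).
  by apply: eq_left_bracket => j _; rewrite /ext ffunE.
- exact: left_bracket_nambu.
Qed.
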